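(* Let $T$ be a marked tree (a finite tree in which some, possibly none, of the vertices are marked). Then $T$ is an intersection graph for a chord diagram on two components (i.e. $T$ is isomorphic, as a marked graph, to the marked intersection graph of some chord diagram with two components) if and only if every vertex of $T$ has at most $2$ heavy boughs.
   Context: Chord diagrams. A chord diagram of degree $n$ with $k$ components is a disjoint union of $k$ oriented line segments (the components, labeled $1,\dots,k$), together with $n$ chords (unoriented line segments whose two endpoints lie on the components), such that all $2n$ endpoints of chords are distinct. The diagram is determined by the (linear) orders of the endpoints along each component, together with the pairing of endpoints into chords. The two endpoints of a chord may lie on the same component or on different components. Intersection graphs. The intersection graph $\Gamma(D)$ of a chord diagram $D$ is the labeled directed multigraph with one vertex for each chord of $D$; the vertex of a chord is labeled by the unordered pair $\{i,j\}$ ($i=j$ allowed) of the labels of the components on which the endpoints of the chord lie. For distinct vertices $v_1,v_2$ there is a directed edge from $v_1$ to $v_2$ for each pair $(e_1,e_2)$ such that $e_1$ is an endpoint of the chord of $v_1$, $e_2$ is an endpoint of the chord of $v_2$, $e_1$ and $e_2$ lie on the same component, and the orientation of that component runs from $e_1$ to $e_2$. Edges are counted mod 2: two directed edges with the same direction between the same two vertices cancel. If two vertices are joined by a directed edge in each direction, this is regarded as a single undirected edge. For diagrams with two components every remaining edge is undirected in this sense, so the intersection graph is an undirected graph. Marked graphs. For a diagram with two components, a vertex of the intersection graph is called marked if its label is $\{1,2\}$ (the chord has endpoints on different components) and unmarked if its label is $\{1,1\}$ or $\{2,2\}$. The marked intersection graph remembers only the graph and which vertices are marked. A marked tree is a finite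 (undirected, connected, acyclic) tree together with a (possibly empty) set of marked vertices. Boughs. A bough of a vertex $v$ in a marked tree $T$ is a connected component of $T\setminus v$ (the graph obtained by removing $v$ and all edges incident to $v$). The bough is light if it contains at most one marked vertex and this vertex (if present) is adjacent to $v$ in $T$. Otherwise the bough is heavy. *)

(* Defs.v *)
From mathcomp Require Import all_boot.

Set Implicit Arguments.
Unset Strict Implicit.
Unset Printing Implicit Defensive.

(* The endpoints of the chords are the positions (i, p) with p < size (word i),
   ordered along component i by p; the letter at a position is the chord it
   belongs to. *)
Record chord_diagram (k n : nat) := ChordDiagram {
  word : 'I_k -> seq 'I_n;
  word_count : forall c : 'I_n, \sum_(i < k) count_mem c (word i) = 2
}.

Section IntersectionGraph.
Variables (k n : nat) (D : chord_diagram k n).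

(* The unordered pair {i, j} of components carrying the two endpoints of c;
   it is a singleton when i = j. *)
Definition label (c : 'I_n) : {set 'I_k} := [set i | c \in word D i].

Definition endpoint_at (i : 'I_k) (p : 'I_(size (word D i))) : 'I_n :=
  tnth (in_tuple (word D i)) p.

Definition edge_mult (u v : 'I_n) : nat :=
  \sum_(i < k)
    #|[set pq : 'I_(size (word D i)) * 'I_(size (word D i)) |
        [&& endpoint_at pq.1 == u, endpoint_at pq.2 == v & pq.1 < pq.2]]|.

Definition directed_edge : rel 'I_n :=
  [rel u v | (u != v) && odd (edge_mult u v)].

Lemma directed_edge_irr : irreflexive directed_edge.
Proof. by move=> u; rewrite /directed_edge /= eqxx. Qed.

Lemma card_endpoint_at (i : 'I_k) (c : 'I_n) :
  #|[set p | endpoint_at (i := i) p == c]| = count_mem c (word D i).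
Proof.
rewrite cardsE cardE {1}/enum_mem size_filter -enumT.
have /(congr1 (count_mem c)) := map_tnth_enum (in_tuple (word D i)).
by rewrite count_map.
Qed.

Lemma edge_mult_swap (u v : 'I_n) : u != v ->
  edge_mult u v + edge_mult v u =
  \sum_(i < k) count_mem u (word D i) * count_mem v (word D i).
Proof.
move=> uv; rewrite -big_split /=; apply: eq_bigr => i _.
rewrite -!card_endpoint_at -cardsX.
set C := setX _ _.
set A := [set pq | [&& _, _ & _]]; set B := [set pq | [&& _, _ & _]].
pose sw (pq : 'I_(size (word D i)) * 'I_(size (word D i))) := (pq.2, pq.1).
have sw_inj : injective sw by case=> a b [c d] [-> ->].
rewrite -(card_imset (mem B) sw_inj) -cardsUI.
have -> : A :&: [set sw x | x in B] = set0.
  apply/setP => -[p q]; rewrite !inE /=; apply/negP => /andP[].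
  case/and3P=> _ _ pq /imsetP[[a b]]; rewrite inE /= => /and3P[_ _ ab] [??].
  by subst; rewrite ltnNge ltnW in pq.
rewrite cards0 addn0; congr #|pred_of_set _|; apply/setP => -[p q].
rewrite !inE /=; apply/orP/andP.
  case; first by case/and3P.
  by case/imsetP=> -[a b]; rewrite inE /= => /and3P[? ? _] [-> ->].
case=> pu qv; case: (ltngtP p q) => [pq|qp|/val_inj epq].
- by left; rewrite pu qv.
- by right; apply/imsetP; exists (q, p); rewrite // inE /= pu qv.
- by move: uv; rewrite -(eqP pu) -(eqP qv) epq eqxx.
Qed.

End IntersectionGraph.

Lemma directed_edge_sym (n : nat) (D : chord_diagram 2 n) :
  symmetric (directed_edge D).
Proof.
move=> u v; rewrite /directed_edge /= eq_sym; case: eqVneq => //= vu.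
have := @edge_mult_swap _ _ D u v; rewrite eq_sym vu => /(_ isT).
have := word_count D u; have := word_count D v.
rewrite !big_ord_recl !big_ord0 !addn0 => ev eu es.
suff: odd (edge_mult D u v + edge_mult D v u) = false.
  by rewrite oddD; do 2!case: (odd _).
move/(congr1 odd): eu; move/(congr1 odd): ev; rewrite es !oddD !oddM /=.
by do 4!case: (odd (count _ _)).
Qed.

Record marked_graph := MarkedGraph {
  vertex : finType;
  edge : rel vertex;
  marked : {set vertex};
  edge_sym : symmetric edge;
  edge_irr : irreflexive edge
}.

(* With two components directed edges come in opposite pairs, each pair being
   one undirected edge. *)
Definition marked_intersection_graph n (D : chord_diagram 2 n) : marked_graph :=
  @MarkedGraph 'I_n (directed_edge D) [set c | label D c == [set ord0; ord_max]]
    (@directed_edge_sym n D) (@directed_edge_irr 2 n D).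

Definition isomorphic (G H : marked_graph) : Prop :=
  exists f : vertex G -> vertex H,
    [/\ bijective f,
        forall x y, edge (f x) (f y) = edge x y &
        forall x, (f x \in marked H) = (x \in marked G)].

Definition is_tree (G : marked_graph) : Prop :=
  [/\ 0 < #|vertex G|,
      forall x y : vertex G, connect (@edge G) x y &
      forall s : seq (vertex G), 2 < size s -> ~ ucycle (@edge G) s].

Section Boughs.
Variables (G : marked_graph) (v : vertex G).

Definition edge_minus : rel (vertex G) :=
  [rel x y | [&& x != v, y != v & edge x y]].

Definition boughs : {set {set vertex G}} :=
  equivalence_partition (connect edge_minus) [set~ v].

Definition light (B : {set vertex G}) : bool :=
  (#|B :&: marked G| <= 1) && [forall x in B :&: marked G, edge x v].

Definition heavy_boughs : {set {set vertex G}} :=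
  [set B in boughs | ~~ light B].

End Boughs.

(* Main.v *)
(* Write a diagram on two components as a pair of words in which every letter
   occurs twice in total.

   Necessity: a bough of v is heavy iff it contains a marked m not adjacent to
   v.  A marked chord m cuts the diagram into a part before m and a part after
   m, and a connected set of chords not meeting m lies in one part.  If v had
   three heavy boughs, two of the corresponding marked chords m1, m2 would lie
   on the same side of v; then one of them separates v from the other, although
   the other is joined to v by a path avoiding its neighbours.

   Sufficiency: take r to be the neighbour of v in a smallest heavy bough over
   all v.  Rooted at r, every vertex has at most one heavy bough below it, and
   the tree is grown from r by adding leaves while some vertex v stays at the
   end of a word.  An unmarked leaf y can be attached to any u by replacing an
   occurrence of u by y u y, a marked one to v by (A v, B) -> (A y v, B y).
   Once only the heavy bough of v is left, its root takes over the role of v. *)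
Require Import Defs.
From mathcomp Require Import all_boot zify.

Set Implicit Arguments.
Unset Strict Implicit.
Unset Printing Implicit Defensive.

(** * Counting ordered pairs of occurrences in a word *)

Section Before.
Variable X : eqType.
Implicit Types (u v x : X) (s t : seq X).

(** The contribution of a single component to [edge_mult], in recursive form so that it can be
    computed on concatenations. *)
Fixpoint before u v s : nat :=
  if s is x :: s' then (x == u) * count_mem v s' + before u v s' else 0.

Lemma before_cat u v s t :
  before u v (s ++ t) =
  before u v s + before u v t + count_mem u s * count_mem v t.
Proof. by elim: s => [|x s IH] /=; rewrite ?addn0 // count_cat IH; nia. Qed.

Lemma before_notinl u v s : u \notin s -> before u v s = 0.
Proof.
by elim: s => //= x s IH; rewrite inE negb_or eq_sym => /andP[/negPf-> /IH->].
Qed.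

Lemma before_notinr u v s : v \notin s -> before u v s = 0.
Proof.
elim: s => //= x s IH; rewrite inE negb_or => /andP[_ vs].
by rewrite IH // (count_memPn vs) muln0.
Qed.

Lemma before_swap u v s : u != v ->
  before u v s + before v u s = count_mem u s * count_mem v s.
Proof.
move=> uv; elim: s => //= x s IH.
case: (eqVneq x u) => [->|_]; first by rewrite (negPf uv); nia.
by case: (x == v); nia.
Qed.

(** Summing over natural-number positions lets the head of the word be split off from both indices
    at once. *)
Lemma before_nth x0 u v s :
  \sum_(0 <= p < size s) \sum_(0 <= q < size s)
    [&& nth x0 s p == u, nth x0 s q == v & p < q] = before u v s.
Proof.
elim: s => [|x s IH]; first by rewrite big_geq.
rewrite [size _]/= big_nat_recl //=; congr (_ + _).
  rewrite big_nat_recl //= !andbF add0n -sum1_count big_distrr /=.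
  rewrite (big_nth x0) /= [RHS]big_mkcond /=. apply: eq_bigr => q _.
  by rewrite andbT; case: (x == u); case: (_ == v).
rewrite -IH; apply: eq_bigr => p _.
by rewrite big_nat_recl //= !andbF add0n.
Qed.

Lemma card_before u v s :
  #|[set pq : 'I_(size s) * 'I_(size s) |
      [&& tnth (in_tuple s) pq.1 == u, tnth (in_tuple s) pq.2 == v
        & pq.1 < pq.2]]| = before u v s.
Proof.
rewrite -(before_nth u) big_mkord -sum1dep_card big_mkcond /=.
rewrite (eq_bigr (fun p : 'I_(size s) => \sum_(q < size s)
  [&& nth u s p == u, nth u s q == v & p < q])); last first.
  by move=> p _; rewrite big_mkord.
rewrite pair_big /=; apply: eq_bigr => -[p q] _ /=.
by rewrite !(tnth_nth u) /=; case: ifP.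
Qed.

End Before.

Lemma before_map (X Y : eqType) (f : X -> Y) (u v : X) (s : seq X) :
  injective f -> before (f u) (f v) (map f s) = before u v s.
Proof.
move=> f_inj; elim: s => //= x s ->; rewrite (inj_eq f_inj) count_map.
by congr (_ * _ + _); apply: eq_count => z /=; rewrite (inj_eq f_inj).
Qed.

(** * Two-component diagrams as pairs of words *)

Lemma edge_multE (n : nat) (D : chord_diagram 2 n) (u v : 'I_n) :
  edge_mult D u v =
  before u v (word D ord0) + before u v (word D ord_max).
Proof.
rewrite /edge_mult !big_ord_recl big_ord0 addn0 -!card_before.
by rewrite (_ : lift ord0 ord0 = ord_max); last exact/val_inj.
Qed.

(** A diagram for the subgraph induced on [S], with the vertices themselves as letters. The first
    clause also keeps letters outside [S] from occurring. A chord joins the two components exactly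
    when its letter occurs in both words. *)
Definition realizes (T : marked_graph) (S : {set vertex T})
    (w1 w2 : seq (vertex T)) : Prop :=
  [/\ forall x, count_mem x w1 + count_mem x w2 = (x \in S).*2,
      forall x y, x \in S -> y \in S -> x != y ->
        odd (before x y w1 + before x y w2) = edge x y
    & forall x, x \in S -> (x \in w1) && (x \in w2) = (x \in marked T)].

Lemma realizes_swap (T : marked_graph) (S : {set vertex T})
    (w1 w2 : seq (vertex T)) : realizes S w1 w2 -> realizes S w2 w1.
Proof.
case=> cnt adj mrk; split=> [x|x y xS yS xy|x xS].
- by rewrite addnC.
- by rewrite addnC adj.
- by rewrite andbC mrk.
Qed.

Lemma set2_ord2 (A : {set 'I_2}) :
  (A == [set ord0; ord_max]) = (ord0 \in A) && (ord_max \in A).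
Proof.
apply/eqP/andP => [->|[A0 A1]]; first by rewrite !inE !eqxx.
apply/setP=> i; rewrite !inE; case: (unliftP ord0 i) => [j|] ->.
  by rewrite (ord1 j) (_ : lift _ _ = ord_max) ?A1 //; apply/val_inj.
by rewrite A0.
Qed.

Lemma realizable_words (T : marked_graph) :
  (exists (n : nat) (D : chord_diagram 2 n),
      isomorphic T (marked_intersection_graph D)) <->
  (exists w1 w2 : seq (vertex T), realizes setT w1 w2).
Proof.
have ord_lift : lift ord0 ord0 = ord_max :> 'I_2 by exact/val_inj.
split=> [[n [D [f [[g fK gK] f_edge f_marked]]]]|[w1 [w2 [cnt adj mrk]]]].
  have g_inj := can_inj gK.
  have mem_g x w : (x \in map g w) = (f x \in w).
    by rewrite -{1}(fK x) mem_map.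
  exists (map g (word D ord0)), (map g (word D ord_max)); split.
  - move=> x; have cntE w : count_mem x (map g w) = count_mem (f x) w.
      by rewrite count_map; apply: eq_count => z /=; rewrite -{1}(fK x) inj_eq.
    have := word_count D (f x); rewrite !big_ord_recl big_ord0 addn0 ord_lift.
    by rewrite !cntE inE.
  - move=> x y _ _ xy; rewrite -f_edge /= /directed_edge /= edge_multE.
    rewrite (can_eq fK) xy /=.
    by rewrite -{1 2}(fK x) -{1 2}(fK y) !before_map.
  - by move=> x _; rewrite !mem_g -f_marked /= inE set2_ord2 !inE.
pose f := @enum_rank (vertex T); pose g := @enum_val (vertex T) predT.
have fK : cancel f g by exact: enum_rankK.
have gK : cancel g f by exact: enum_valK.
have f_inj := can_inj fK.
pose w (i : 'I_2) := map f (if i == ord0 then w1 else w2).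
have w_count c : \sum_(i < 2) count_mem c (w i) = 2.
  rewrite !big_ord_recl big_ord0 addn0 /w /= -(gK c) !count_map.
  rewrite !(eq_count (a2 := pred1 (g c))) ?cnt ?inE //;
    by move=> z /=; rewrite inj_eq.
exists #|vertex T|, (ChordDiagram w_count), f; split.
- by exists g.
- move=> x y; rewrite /= /directed_edge /= edge_multE /= /w /=.
  rewrite !before_map // inj_eq //.
  by case: (eqVneq x y) => [->|xy]; rewrite ?edge_irr //= adj ?inE.
- by move=> x; rewrite inE set2_ord2 !inE /= /w /= !mem_map // mrk.
Qed.

(** * Boughs of a tree, indexed by the neighbours of the removed vertex *)

Lemma connect_first (V : finType) (e : rel V) (u z : V) :
  connect e u z -> z != u ->
  exists2 c, e u c & connect [rel x y | [&& x != u, y != u & e x y]] c z.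
Proof.
(* A path without repetitions leaves [u] at its first step and never returns. *)
case/connectP=> p /shortenP[[|c q] /= eq uq _] ->; first by rewrite eqxx.
move=> _; case/andP: eq => uc eq; exists c => //.
apply/connectP; exists q => //.
apply: (@sub_in_path _ (predC1 u)) eq.
  by move=> x y; rewrite !inE /= => -> -> ->.
by apply/allP=> x xq /=; apply: contraNneq (proj1 (andP uq)) => <-.
Qed.

Section Trees.
Variable T : marked_graph.
Hypothesis hT : is_tree T.
Implicit Types (u v w x y z r m : vertex T) (S : {set vertex T}).

Definition branch u y : {set vertex T} := [set z | connect (edge_minus u) y z].

Lemma connect_minusC u : connect_sym (edge_minus u).
Proof.
by apply: sym_connect_sym => x y; rewrite /edge_minus /= edge_sym andbCA.
Qed.

Lemma branch_refl u y : y \in branch u y.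
Proof. by rewrite inE connect0. Qed.

Lemma edge_neq u y : edge u y -> y != u.
Proof. by apply: contraTneq => ->; rewrite edge_irr. Qed.

Lemma path_minus_notin u y p : path (edge_minus u) y p -> u \notin p.
Proof.
elim: p y => //= z p IH y /andP[/and3P[_ zu _] /IH].
by rewrite inE negb_or eq_sym zu.
Qed.

Lemma branch_neq u y z : edge u y -> z \in branch u y -> z != u.
Proof.
move=> /edge_neq yu; rewrite inE => /connectP[p /path_minus_notin up ->].
apply: contraNneq up; move: yu; case: p => [|c p] /= yu.
  by move=> yE; rewrite yE eqxx in yu.
by move=> <-; exact: mem_last.
Qed.

(** This is where acyclicity enters: a path from [y] to a different [y'] avoiding [u] would close up
    through [u] to a cycle of length at least 3. *)
Lemma branch_inj u y y' :
  edge u y -> edge u y' -> y' \in branch u y -> y' = y.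
Proof.
move=> uy uy'; rewrite inE => /connectP[p0 /shortenP[p pp up _] y'E].
case: p pp up y'E => [//|c p] pp up y'E.
case: hT => _ _ /(_ [:: u, y, c & p]) []; first by [].
have -> : ucycle (@edge T) [:: u, y, c & p] <->
  [&& edge u y, path (@edge T) y (c :: p), edge (last y (c :: p)) u
    & uniq [:: u, y, c & p]].
  by rewrite /ucycle /= rcons_path -!andbA.
have -> : uniq [:: u, y, c & p].
  by rewrite cons_uniq up inE negb_or eq_sym edge_neq //= (path_minus_notin pp).
rewrite uy -y'E edge_sym uy' andbT /=.
by apply/andP; split=> //; apply: sub_path pp => a b /and3P[].
Qed.

Lemma branch_cover u z : z != u -> exists2 y, edge u y & z \in branch u y.
Proof.
case: hT => _ /(_ u z) uz _ /(connect_first uz)[y uy yz].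
by exists y; rewrite ?inE.
Qed.

(** The path from [y] to [z] avoiding [u] stays in [branch u y], so it misses [w]. *)
Lemma connect_switch u y z w :
  z \in branch u y -> w \notin branch u y -> connect (edge_minus w) y z.
Proof.
rewrite inE => /connectP[p pp ->]; elim: p y pp => //= c p IH y.
case/andP=> yc pp wy; have yc' := connect1 yc.
have wc : w \notin branch u c.
  by apply: contra wy; rewrite !inE; apply: connect_trans.
apply: connect_trans (IH c pp wc); apply: connect1.
rewrite /edge_minus /=; case/and3P: yc => _ _ ->; rewrite andbT.
apply/andP; split; apply: contraNneq wy => <-; first exact: branch_refl.
by rewrite inE.
Qed.

(** By [connect_switch], any vertex of [branch w y] is reached from [y] without meeting [u];
    prefixing the walk from [r] to [w] and the edge to [y] keeps it in the bough of [u]. *)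
Lemma branch_sub u r w y : edge u r -> w \in branch u r -> edge w y ->
  u \notin branch w y -> branch w y \subset branch u r.
Proof.
move=> ur wr wy uy; apply/subsetP=> z zy; have := connect_switch zy uy.
rewrite inE => yz; apply: connect_trans yz.
move: (wr); rewrite inE => /connect_trans; apply; apply: connect1.
rewrite /edge_minus /= wy (branch_neq ur wr) /= andbT.
by apply: contraNneq uy => <-; apply: branch_refl.
Qed.

Lemma root_notin_branch w y : edge w y -> w \notin branch w y.
Proof. by move=> wy; apply/negP=> /(branch_neq wy); rewrite eqxx. Qed.

Lemma branch_child u y z :
  edge u y -> edge y z -> z != u -> branch y z \subset branch u y.
Proof.
move=> uy yz zu; apply: branch_sub => //; first exact: branch_refl.
apply: contra zu => uz; apply/eqP; apply/esym.
by apply: (branch_inj yz) => //; rewrite edge_sym.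
Qed.

(* In a bough of a tree only one vertex is adjacent to [u], so the bough is
   heavy exactly when it contains a marked vertex not adjacent to [u]. *)
Definition heavy u y := [exists m in branch u y :&: marked T, ~~ edge u m].

Definition heavy_nbrs u := [set y | edge u y & heavy u y].

Lemma light_branch u y : edge u y -> light u (branch u y) = ~~ heavy u y.
Proof.
move=> uy; rewrite /light /heavy negb_exists_in.
rewrite (eq_forallb (P2 := fun m =>
  (m \in branch u y :&: marked T) ==> ~~ ~~ edge u m)); last first.
  by move=> m; rewrite edge_sym negbK.
case: forall_inP; rewrite ?andbF // => nbr; rewrite andbT.
apply/card_le1_eqP=> m m' /[dup] mB /nbr /negPn um /[dup] m'B /nbr /negPn um'.
case/setIP: mB => mB _; case/setIP: m'B => m'B _.
by rewrite (branch_inj uy um mB) (branch_inj uy um' m'B).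
Qed.

Lemma boughsE u : boughs u = [set branch u y | y in [set y | edge u y]].
Proof.
have classE x : x != u -> [set z in [set~ u] | connect (edge_minus u) x z]
    = branch u x.
  move=> xu; apply/setP=> z; rewrite !inE.
  have [y uy xy] := branch_cover xu.
  apply: andb_idl => xz; apply: (branch_neq uy).
  by move: xy; rewrite !inE => /connect_trans; apply.
apply/setP=> B; apply/imsetP/imsetP => [[x]|[y]].
  rewrite !inE => xu ->; rewrite (classE _ xu).
  have [y uy xy] := branch_cover xu; exists y; first by rewrite inE.
  apply/setP=> z; rewrite !inE; move: xy; rewrite inE => xy.
  by rewrite (same_connect (@connect_minusC u) xy).
rewrite inE => uy ->; exists y; first by rewrite !inE edge_neq.
by rewrite classE // edge_neq.
Qed.

Lemma card_heavy_boughs u : #|heavy_boughs u| = #|heavy_nbrs u|.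
Proof.
have -> : heavy_boughs u = branch u @: heavy_nbrs u.
  apply/setP=> B; rewrite inE boughsE.
  apply/andP/imsetP => [[/imsetP[y]]|[y]].
    by rewrite inE => uy ->; rewrite light_branch // negbK; exists y;
      rewrite ?inE ?uy.
  rewrite inE => /andP[uy hy] ->; rewrite light_branch // negbK; split=> //.
  by apply: imset_f; rewrite inE.
apply: card_in_imset => y y'; rewrite !inE => /andP[uy _] /andP[uy' _] E.
by apply: (branch_inj uy') => //; rewrite -E branch_refl.
Qed.

Lemma exists_root : (forall v, #|heavy_nbrs v| <= 2) ->
  exists r, forall v, #|[set y in heavy_nbrs v | r \notin branch v y]| <= 1.
Proof.
move=> le2.
case: (pickP (fun p : vertex T * vertex T => p.2 \in heavy_nbrs p.1))
  => [p0 hp0|no].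
  (* The root [r] is the neighbour of [u] in a heavy bough of minimal size. *)
  case: (@arg_minnP _ p0 (fun p => p.2 \in heavy_nbrs p.1)
    (fun p => #|branch p.1 p.2|) hp0) => -[u r] /= hr minr.
  have := hr; rewrite inE => /andP[ur /exists_inP[m /setIP[mr mM] um]].
  exists r => w; rewrite leqNgt; apply/negP => /card_gt1P[y1 [y2 []]].
  rewrite inE => /andP[h1 r1]; rewrite inE => /andP[h2 r2] y12.
  have w1 : edge w y1 by move: h1; rewrite inE => /andP[].
  have w2 : edge w y2 by move: h2; rewrite inE => /andP[].
  (* For [w] inside the minimal bough, a heavy bough of [w] missing [u] would be strictly smaller,
     as it lacks [w]. So both boughs contain [u] and coincide. *)
  have [wr|wr] := boolP (w \in branch u r).
    have small y : y \in heavy_nbrs w -> edge w y ->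
        u \notin branch w y -> False.
      move=> hy wy uy; have /= := minr (w, y) hy.
      rewrite leqNgt => /negP; apply; apply: proper_card.
      apply/properP; split; first exact: branch_sub.
      by exists w => //; exact: root_notin_branch.
    have [u1|] := boolP (u \in branch w y1); last exact: small.
    have [u2|] := boolP (u \in branch w y2); last exact: small.
    case/eqP: y12; apply: (branch_inj w2) => //.
    move: u1 u2; rewrite !inE connect_minusC => u1 u2.
    exact: connect_trans u2 u1.
  (* For [w] outside, the bough of [w] containing [r] also contains the marked vertex [m] and is
     heavy; it would be a third heavy bough of [w]. *)
  have rw : r != w by apply: contraNneq wr => <-; exact: branch_refl.
  have [y3 w3 r3] := branch_cover rw.
  suff h3 : y3 \in heavy_nbrs w.
    have := le2 w; rewrite leqNgt => /negP; apply; apply/card_gt2P.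
    exists y1, y2, y3; split=> //; split=> //.
      by apply: contraNneq r2 => ->.
    by apply: contraNneq r1 => <-.
  rewrite inE w3; apply/exists_inP; exists m.
    rewrite inE mM andbT inE; move: r3; rewrite inE => /connect_trans; apply.
    exact: connect_switch mr wr.
  (* A neighbour of [m] other than [u] lies in [branch u r], so [w] is not adjacent to [m]. *)
  have [->//|wu] := eqVneq w u; apply: contra wr => wm.
  move: (mr); rewrite !inE => /connect_trans; apply; apply: connect1.
  by rewrite /edge_minus /= (branch_neq ur mr) wu edge_sym.
case: hT => /card_gt0P[r _] _ _; exists r => v.
rewrite leqNgt; apply/negP => /card_gt1P[y1 [y2 []]].
by rewrite inE (no (v, y1)).
Qed.

(** Says that [S] is a subtree containing [r]: no vertex outside [S] separates [r] from a vertex of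
    [S], so the tree path between them stays in [S]. *)
Definition rooted r S :=
  r \in S /\ forall y a, y \notin S -> a \in S -> connect (edge_minus y) r a.

(** All of [S] lies in a single bough of [y], and a bough contains only one neighbour of [y]. Hence
    [y] is attached to [S] as a leaf. *)
Lemma rooted_edge r S u y p : rooted r S -> u \in S -> y \notin S ->
  edge u y -> p \in S -> edge y p = (p == u).
Proof.
move=> [_ conS] uS yS uy pS; apply/idP/eqP => [yp|->]; last by rewrite edge_sym.
apply: (@branch_inj y) => //; first by rewrite edge_sym.
rewrite inE; apply: connect_trans (conS y p yS pS).
by rewrite connect_minusC conS.
Qed.

Lemma rooted_add r S u y :
  rooted r S -> u \in S -> edge u y -> rooted r (y |: S).
Proof.
move=> [rS conS] uS uy; split; first by rewrite !inE rS orbT.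
move=> z a; rewrite !inE negb_or => /andP[zy zS] /orP[/eqP->|aS];
  last exact: conS.
apply: connect_trans (conS z u zS uS) _; apply: connect1.
rewrite /edge_minus /= uy (eq_sym y) zy !andbT.
by apply: contraNneq zS => <-.
Qed.

(** The path from [u] to [r] avoiding [y] starts at a neighbour [c] of [u]. If [r] were in the bough
    of [y], so would be [c], forcing [c = y]. *)
Lemma rooted_branch r S u y :
  rooted r S -> u \in S -> y \notin S -> edge u y -> r \notin branch u y.
Proof.
move=> [rS conS] uS yS uy; apply/negP=> ry; have ru := branch_neq uy ry.
have /connect_first : connect (edge_minus y) u r by rewrite connect_minusC conS.
case/(_ ru)=> c /and3P[_ cy uc] cr; case/eqP: cy.
apply: (branch_inj uy uc); move: ry; rewrite !inE => /connect_trans; apply.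
rewrite connect_minusC; apply: connect_sub cr => a b.
case/and3P=> au bu /and3P[_ _ ab].
by apply: connect1; rewrite /edge_minus /= au bu.
Qed.

Lemma rooted_frontier r S : rooted r S -> S != setT ->
  exists u y, [/\ u \in S, y \notin S & edge u y].
Proof.
move=> [rS _] ST.
have [z zS] : exists z, z \notin S.
  apply/existsP; rewrite -negb_forall; apply: contra ST => /forallP ST.
  by apply/eqP/setP=> z; rewrite ST inE.
have [_ /(_ r z) /connectP[p pp zE] _] := hT; rewrite {}zE in zS.
 elim: p r rS pp zS => [|c p IH] x xS /= => [_|]; first by rewrite xS.
case/andP=> xc pp zS; have [cS|cS] := boolP (c \in S); first exact: IH pp zS.
by exists x, c.
Qed.

End Trees.

(** * Attaching a leaf to a pair of words *)

Lemma realizes_insert (T : marked_graph) (S : {set vertex T})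
    (A B C : seq (vertex T)) (u y : vertex T) :
  realizes S (A ++ u :: B) C -> y \notin S -> y \notin marked T ->
  (forall p, p \in S -> edge y p = (p == u)) ->
  realizes (y |: S) (A ++ [:: y; u; y] ++ B) C.
Proof.
move=> [cnt adj mrk] yS yM nbr.
have := cnt y; rewrite (negPf yS) double0 count_cat /= => /eqP.
rewrite !addn_eq0 eqb0 -andbA -andbA.
case/and4P=> /eqP/count_memPn yA uy /eqP/count_memPn yB /eqP/count_memPn yC.
have cS p : p \in S -> p == y = false.
  by move=> pS; apply: contraNF yS => /eqP<-.
split=> [x|x z|x].
- have := cnt x; rewrite !inE !count_cat /= !(eq_sym y).
  by case: (eqVneq x y) => [->|_] /=; rewrite ?(negPf yS) /= ?(negPf uy); lia.
(* The two letters [y] enclose one occurrence of [u] and nothing else. Every other occurrence lies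
   on one side of both and contributes an even number. *)
- rewrite !inE => /orP[/eqP->|xS] /orP[/eqP->|zS]; first by rewrite eqxx.
  + move=> _; rewrite nbr // !before_cat /= !(before_notinl _ yA)
      !(before_notinl _ yB) !(before_notinl _ yC) (count_memPn yA) eqxx
      (eq_sym y) (cS _ zS) (negPf uy) (eq_sym z) /=.
    rewrite !(mul0n, mul1n, add0n, addn0).
    by rewrite -addnA addnn oddD odd_double addbF; case: eqP.
  + move=> _; rewrite edge_sym nbr // !before_cat /= !(before_notinr _ yA)
      !(before_notinr _ yB) !(before_notinr _ yC) (count_memPn yB) eqxx
      (eq_sym y) (cS _ xS) (negPf uy) (eq_sym x) /=.
    rewrite !(mul0n, mul1n, muln1, add0n, addn0) muln2.
    by rewrite oddD odd_double addbF; case: eqP.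
  + move=> xz; rewrite -adj // !before_cat /= (eq_sym y x) (eq_sym y z).
    by rewrite (cS _ xS) (cS _ zS) /= !(mul0n, add0n, addn0, muln0).
- rewrite !inE => /orP[/eqP->|xS].
    by rewrite (negPf yC) andbF (negPf yM).
  by rewrite -mrk // !mem_cat !inE !(cS _ xS).
Qed.

Lemma realizes_snoc (T : marked_graph) (S : {set vertex T})
    (A B : seq (vertex T)) (v y : vertex T) :
  realizes S (rcons A v) B -> y \notin S -> y \in marked T ->
  (forall p, p \in S -> edge y p = (p == v)) ->
  realizes (y |: S) (rcons (rcons A y) v) (rcons B y).
Proof.
move=> [cnt adj mrk] yS yM nbr.
have := cnt y; rewrite (negPf yS) double0 -cats1 count_cat /= => /eqP.
rewrite !addn_eq0 eqb0 andbT -andbA.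
case/and3P=> /eqP/count_memPn yA vy /eqP/count_memPn yB.
have cS p : p \in S -> p == y = false.
  by move=> pS; apply: contraNF yS => /eqP<-.
rewrite -!cats1 -catA /= in cnt adj mrk *.
split=> [x|x z|x].
- have := cnt x; rewrite !inE !count_cat /= !(eq_sym y).
  by case: (eqVneq x y) => [->|_] /=; rewrite ?(negPf yS) /= ?(negPf vy); lia.
- rewrite !inE => /orP[/eqP->|xS] /orP[/eqP->|zS]; first by rewrite eqxx.
  + move=> _; rewrite nbr // !before_cat /= !(before_notinl _ yA)
      !(before_notinl _ yB) (count_memPn yA) (count_memPn yB) eqxx
      (eq_sym y) (cS _ zS) (negPf vy) (eq_sym z) /=.
    by rewrite !(mul0n, mul1n, muln0, add0n, addn0); case: eqP.
  + move=> _; rewrite edge_sym nbr // !before_cat /= !(before_notinr _ yA)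
      !(before_notinr _ yB) eqxx
      (eq_sym y) (cS _ xS) (negPf vy) /=.
    (* All occurrences of [x] in [A] and [B] precede [y]: there are 2 of them, or 1 if [x] is [v],
       whose last occurrence comes after [y]. *)
    have := cnt x; rewrite xS count_cat /= (eq_sym v) => cx.
    by apply/idP/idP; case: eqP cx => _ cx; lia.
  + move=> xz; rewrite -adj // !before_cat /= (eq_sym y x) (eq_sym y z).
    by rewrite (cS _ xS) (cS _ zS) /= !(add0n, addn0, muln0).
- rewrite !inE => /orP[/eqP->|xS].
    by rewrite yM !mem_cat !inE eqxx !orbT.
  by rewrite -mrk // !mem_cat !inE !(cS _ xS) !orbF.
Qed.

(** Only one of the two occurrences of [u] can be the final [v]; enclosing another one leaves [v] at
    the end of its word. *)
Lemma realizes_insert_open (T : marked_graph) (S : {set vertex T})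
    (A B : seq (vertex T)) (v u y : vertex T) :
  realizes S (rcons A v) B -> u \in S -> y \notin S -> y \notin marked T ->
  (forall p, p \in S -> edge y p = (p == u)) ->
  exists A' B', realizes (y |: S) (rcons A' v) B'.
Proof.
move=> RS uS yS yM nbr; have : (u \in A) || (u \in B).
  case: (RS) => /(_ u) + _ _; rewrite uS -cats1 count_cat /=.
  rewrite -!has_pred1 !has_count. rewrite -mul2n muln1.
  by move: (count_mem u A) (count_mem u B) => a b; case: eqP => _; lia.
case/orP=> /splitPr uAB; case: uAB RS => C D RS.
  exists (C ++ [:: y; u; y] ++ D), B; rewrite rcons_cat.
  by apply: realizes_insert; rewrite // -rcons_cons -rcons_cat.
exists A, (C ++ [:: y; u; y] ++ D); apply: realizes_swap.
by apply: realizes_insert => //; apply: realizes_swap.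
Qed.

(** * Sufficiency: growing a diagram from the root *)

Section Sufficiency.
Variable T : marked_graph.
Hypothesis hT : is_tree T.
Implicit Types (u v x y z r m : vertex T) (S : {set vertex T}).

Definition no_mark u y := [disjoint branch u y & marked T].

Lemma no_mark_child u y z :
  edge u y -> edge y z -> z != u -> no_mark u y -> no_mark y z.
Proof. by move=> uy yz zu; apply/disjointWl/(branch_child hT uy yz zu). Qed.

(** In a light bough a marked vertex is adjacent to [u], hence equal to [y], and [y] is in none of
    its own boughs. *)
Lemma light_no_mark_child u y z :
  edge u y -> edge y z -> z != u -> ~~ heavy u y -> no_mark y z.
Proof.
move=> uy yz zu; apply: contraR => /pred0Pn[m /= /andP[mz mM]].
have my : m \in branch u y := subsetP (branch_child hT uy yz zu) m mz.
apply/exists_inP; exists m; first by rewrite inE my.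
apply: contraL mz => um; rewrite (branch_inj hT uy um my).
exact: root_notin_branch.
Qed.

Lemma light_marked u y : edge u y -> ~~ heavy u y -> ~~ no_mark u y ->
  y \in marked T.
Proof.
move=> uy lt /pred0Pn[m /= /andP[my mM]].
suff um : edge u m by rewrite -(branch_inj hT uy um my).
by apply: contraR lt => um; apply/exists_inP; exists m; rewrite // inE my.
Qed.

Lemma realizes1 r : exists A B, realizes [set r] (rcons A r) B.
Proof.
have eq1 x y : x \in [set r] -> y \in [set r] -> x = y.
  by rewrite !inE => /eqP-> /eqP->.
have [rM|rM] := boolP (r \in marked T);
  [exists [::], [:: r]|exists [:: r], [::]].
  split=> [x|x y xr yr|x]; rewrite ?inE /=; first by rewrite eq_sym; case: eqP.
    by rewrite (eq1 _ _ xr yr) eqxx.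
  by move/eqP->; rewrite eqxx rM.
split=> [x|x y xr yr|x]; rewrite ?inE /=; first by rewrite eq_sym; case: eqP.
  by rewrite (eq1 _ _ xr yr) eqxx.
by move/eqP->; rewrite andbF (negPf rM).
Qed.

(* [v], the last letter of a word, is the only vertex at which marked chords
   can still be attached. *)
Lemma realizes_grow r S v (A B : seq (vertex T)) :
  (forall u, #|[set y in heavy_nbrs u | r \notin branch u y]| <= 1) ->
  rooted r S -> v \in S -> realizes S (rcons A v) B ->
  (forall u y, u \in S -> y \notin S -> edge u y -> u != v -> no_mark u y) ->
  exists w1 w2, realizes [set: vertex T] w1 w2.
Proof.
move=> le1; have [n] := ubnP #|~: S|; elim: n S v A B => // n IH S v A B ltn.
move=> rS vS RS bare.
have [ST|ST] := eqVneq S setT; first by exists (rcons A v), B; rewrite -ST.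
(* The induction hypothesis after attaching [y] to [u], with [v'] as the next open vertex. The
   invariant has to be rechecked on the edges leaving [y] and on the older frontier edges. *)
have step u y v' A' B' : u \in S -> y \notin S -> edge u y -> v' \in y |: S ->
    realizes (y |: S) (rcons A' v') B' ->
    (forall z, z \notin S -> edge y z -> z != u -> y != v' -> no_mark y z) ->
    (forall x z, x \in S -> z \notin S -> z != y -> edge x z -> x != v' ->
      no_mark x z) ->
    exists w1 w2, realizes [set: vertex T] w1 w2.
  move=> uS yS uy v'S R' new old; apply: IH R' _ => //.
  - rewrite -ltnS; apply: leq_trans ltn; rewrite ltnS.
    apply: proper_card; apply/properP; split.
      by rewrite setCS subsetUr.
    by exists y; rewrite !inE ?eqxx.
  - exact: rooted_add rS uS uy.
  move=> x z; rewrite !inE negb_or => xS /andP[zy zS] xz xv.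
  have [xE|xy] := eqVneq x y; last by apply: old; rewrite // (negPf xy) in xS *.
  rewrite xE in xz xv *; apply: new => //.
  by apply: contraNneq zS => ->.
have nbr u y : u \in S -> y \notin S -> edge u y ->
    forall p, p \in S -> edge y p = (p == u).
  by move=> uS yS uy p; apply: rooted_edge rS uS yS uy.
pose frontier (p : vertex T * vertex T) :=
  [&& p.1 \in S, p.2 \notin S & edge p.1 p.2].
(* Boughs without marks go first: they can be attached at any [u], and the boughs below [y] are
   again without marks. *)
case: (pickP (fun p => frontier p && no_mark p.1 p.2)) => [[u y]|all_marked].
  case/andP=> /and3P[/= uS yS uy] nm.
  have yM : y \notin marked T.
    by rewrite (disjointFr nm) ?branch_refl.
  have [A' [B' R']] := realizes_insert_open RS uS yS yM (nbr _ _ uS yS uy).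
  apply: (step u y v) R' _ _ => //; first by rewrite inE vS orbT.
    by move=> z _ yz zu _; apply: no_mark_child nm.
  by move=> x z xS zS _; apply: bare.
have marked_v u y : u \in S -> y \notin S -> edge u y ->
    u = v /\ ~~ no_mark v y.
  move=> uS yS uy; have /= := all_marked (u, y).
  rewrite /frontier /= uS yS uy /=.
  have [<- ->//|uv] := eqVneq u v.
  by rewrite bare.
(* Next come the light boughs of [v]: here [y] is marked and nothing below it is, so [v] remains the
   open vertex. *)
case: (pickP (fun p => frontier p && ~~ heavy p.1 p.2)) => [[u y]|all_heavy].
  case/andP=> /and3P[/= uS yS uy]; have [uE nm] := marked_v u y uS yS uy.
  rewrite {}uE in uS uy * => lt.
  have yM := light_marked uy lt nm.
  have R' := realizes_snoc RS yS yM (nbr _ _ vS yS uy).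
  apply: (step v y v) R' _ _ => //; first by rewrite inE vS orbT.
    by move=> z _ yz zu _; apply: light_no_mark_child lt.
  by move=> x z xS zS _; apply: bare.
have [u [y [uS yS uy]]] := rooted_frontier hT rS ST.
have [uE _] := marked_v u y uS yS uy; rewrite {}uE in uS uy.
(* All remaining boughs are heavy boughs of [v] missing the root, and there is at most one of
   these. *)
have heavy_uniq x z : x \in S -> z \notin S -> edge x z -> z = y.
  move=> xS zS xz; have [xE _] := marked_v x z xS zS xz; rewrite xE in xz.
  have in_set t : t \notin S -> edge v t ->
      t \in [set t in heavy_nbrs v | r \notin branch v t].
    move=> tS vt; rewrite 2!inE vt (rooted_branch hT rS vS tS vt) andbT /=.
    by move: (all_heavy (v, t)); rewrite /frontier /= vS tS vt => /negbFE.
  by have /card_le1_eqP := le1 v; apply; apply: in_set.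
(* The new leaf must itself end a word. If marked, it ends the second word, so the words are
   exchanged; if unmarked, the final [v] is replaced by [y v y]. *)
have [A' [B' R']] : exists A' B', realizes (y |: S) (rcons A' y) B'.
  have [yM|yM] := boolP (y \in marked T).
    exists B, (rcons (rcons A y) v); apply: realizes_swap.
    by apply: realizes_snoc => //; apply: nbr.
  exists (A ++ [:: y; v]), B; rewrite rcons_cat /=.
  have := @realizes_insert _ S A [::] B v y; rewrite cats1 /=; apply=> //.
  exact: nbr.
(* By [heavy_uniq] nothing else hangs on [v], so the role of open vertex passes to [y]. *)
apply: (step v y y) R' _ _ => //; first by rewrite !inE eqxx.
  by move=> z _ _ _; rewrite eqxx.
by move=> x z xS zS zy xz; rewrite (heavy_uniq x z) ?eqxx in zy.
Qed.

Lemma heavy_realizable : (forall v, #|heavy_boughs v| <= 2) ->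
  exists w1 w2, realizes [set: vertex T] w1 w2.
Proof.
move=> le2; have [|r le1] := exists_root hT.
  by move=> v; rewrite -card_heavy_boughs.
have [A [B R1]] := realizes1 r.
apply: realizes_grow le1 _ _ R1 _; rewrite ?inE //.
  split=> [|y a yr]; rewrite inE // => /eqP->; exact: connect0.
by move=> u y; rewrite !inE => ->.
Qed.

End Sufficiency.

(** * Necessity: marked chords separate the diagram *)

Section Necessity.
Variables (T : marked_graph) (w1 w2 : seq (vertex T)).
Hypothesis (hT : is_tree T) (R : realizes [set: vertex T] w1 w2).
Implicit Types (u v x y z m : vertex T).

(* For a marked [m] and a [u] not adjacent to it, [side m u] is 0 or 2: both
   endpoints of [u] lie before, or both lie after, those of [m]. *)
Definition side m u := before m u w1 + before m u w2.

Lemma count_both x : count_mem x w1 + count_mem x w2 = 2.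
Proof. by case: R => ->; rewrite inE. Qed.

Lemma odd_side x y : x != y -> odd (side x y) = edge x y.
Proof. by case: R => _ adj _ xy; rewrite /side adj ?inE. Qed.

Lemma count_marked m : m \in marked T ->
  count_mem m w1 = 1 /\ count_mem m w2 = 1.
Proof.
case: R => _ _ <-; rewrite ?inE // -!has_pred1 !has_count.
have := count_both m; move: (count_mem m w1) (count_mem m w2) => a b; lia.
Qed.

Lemma side_swap m u : m \in marked T -> m != u -> side m u + side u m = 2.
Proof.
move=> /count_marked[m1 m2] mu; rewrite /side addnACA !before_swap //.
by rewrite m1 m2 !mul1n count_both.
Qed.

Lemma side02 m u : m \in marked T -> m != u -> ~~ edge m u ->
  side m u = 0 \/ side m u = 2.
Proof.
move=> mM mu; rewrite -odd_side //; have := side_swap mM mu.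
by case: (side m u) => [|[|[|k]]] //= _ _; [left|right].
Qed.

Lemma before_split m u A1 A2 :
  m != u -> count_mem m (A1 ++ m :: A2) = 1 ->
  before m u (A1 ++ m :: A2) = count_mem u A2.
Proof.
rewrite count_cat /= eqxx => /negPf mu m1.
have [mA1 mA2] : count_mem m A1 = 0 /\ count_mem m A2 = 0.
  by move: (count_mem m A1) (count_mem m A2) m1 => a b; lia.
rewrite before_cat /= eqxx mA1 !before_notinl; try exact/count_memPn.
by rewrite mul1n mul0n !addn0.
Qed.

Lemma before_separated m x y A1 A2 : m != x -> m != y ->
  x \notin A2 -> y \notin A1 ->
  before x y (A1 ++ m :: A2) =
  count_mem x (A1 ++ m :: A2) * count_mem y (A1 ++ m :: A2).
Proof.
move=> /negPf mx /negPf my xA yA.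
rewrite before_cat !count_cat /= mx my mul0n.
rewrite (before_notinr _ yA) (before_notinl _ xA).
by rewrite (count_memPn xA) (count_memPn yA) !(add0n, addn0).
Qed.

(** In both words [x] occurs only before [m] and [y] only after it, so every pair of occurrences in
    the same word counts. *)
Lemma side_zero_two m x y : m \in marked T -> m != x -> m != y -> x != y ->
  side m x = 0 -> side m y = 2 -> ~~ edge x y.
Proof.
move=> mM mx my xy; rewrite -(odd_side xy) /side.
have [m1 m2] := count_marked mM.
have m_in w : count_mem m w = 1 -> m \in w.
  by rewrite -has_pred1 has_count => ->.
have := count_both x; have := count_both y; move: (m1) (m2).
case/splitPr: (m_in _ m1) => A1 A2.
case/splitPr: (m_in _ m2) => B1 B2 mA mB cy cx.
rewrite !before_split // => x0 y2.
have [xA2 xB2] : count_mem x A2 = 0 /\ count_mem x B2 = 0.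
  by move: (count_mem x A2) (count_mem x B2) x0 => a b; lia.
have [yA1 yB1] : count_mem y A1 = 0 /\ count_mem y B1 = 0.
  move: cy y2; rewrite !count_cat /= (negPf my).
  move: (count_mem y A1) (count_mem y A2) (count_mem y B1) (count_mem y B2).
  by move=> a b c d; lia.
rewrite !before_separated //; try exact/count_memPn.
move: (count_mem x (A1 ++ _)) (count_mem x (B1 ++ _))
  (count_mem y (A1 ++ _)) (count_mem y (B1 ++ _)) cx cy => a b c d cx cy.
(* Obtained from [b = 2 - a] and [d = 2 - c]; as [a] and [c] are at most 2, the subtraction does not
   truncate. *)
have -> : a * c + b * d = (a * c + 2 - (a + c)).*2 by nia.
by rewrite odd_double.
Qed.

Lemma side_edge m x y : m \in marked T -> m != x -> m != y ->
  ~~ edge m x -> ~~ edge m y -> edge x y -> side m x = side m y.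
Proof.
move=> mM mx my nmx nmy xy.
have nxy : x != y by rewrite eq_sym (edge_neq xy).
have [x0|x2] := side02 mM mx nmx; have [y0|y2] := side02 mM my nmy.
- by rewrite x0 y0.
- by have /negP := side_zero_two mM mx my nxy x0 y2.
- by rewrite eq_sym in nxy; have /negP := side_zero_two mM my mx nxy y0 x2;
    rewrite edge_sym.
by rewrite x2 y2.
Qed.

(** Neither [v] nor any vertex of [branch v y1] is equal or adjacent to [m2], so by [side_edge] the
    value of [side m2] is constant along the path from [m1] through [y1] to [v]. *)
Lemma side_branch v y1 y2 m1 m2 : edge v y1 -> edge v y2 -> y1 != y2 ->
  m1 \in branch v y1 -> m2 \in branch v y2 -> m2 \in marked T ->
  ~~ edge v m2 -> side m2 v = side m2 m1.
Proof.
move=> vy1 vy2 y12 m1y m2y mM vm2.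
have apart z : z \in branch v y1 -> z \notin branch v y2.
  rewrite !inE => y1z; apply: contra y12 => y2z.
  apply/eqP/(branch_inj hT vy2 vy1); rewrite inE.
  by apply: connect_trans y2z _; rewrite connect_minusC.
have neq z : z \in branch v y1 -> m2 != z.
  by move=> zy; apply: contraTneq m2y => ->; apply: apart.
have nonadj z : z \in branch v y1 -> ~~ edge m2 z.
  move=> zy; apply: contra (apart z zy) => m2z.
  move: (m2y); rewrite !inE => /connect_trans; apply; apply: connect1.
  by rewrite /edge_minus /= (branch_neq vy2 m2y) (branch_neq vy1 zy).
have side_y1 z : z \in branch v y1 -> side m2 y1 = side m2 z.
  rewrite inE => /connectP[p]; elim/last_ind: p z => [|p c IH] z /=.
    by move=> _ ->.
  rewrite rcons_path last_rcons => /andP[pp pc] ->.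
  have py : last y1 p \in branch v y1 by rewrite inE; apply/connectP; exists p.
  have cy : c \in branch v y1.
    by move: (py); rewrite !inE => /connect_trans; apply; apply: connect1.
  rewrite (IH _ pp erefl); case/and3P: pc => _ _ pc.
  by apply: side_edge => //;
    [exact: neq|exact: neq|exact: nonadj|exact: nonadj].
rewrite -(side_y1 _ m1y); apply: side_edge => //.
- exact: branch_neq vy2 m2y.
- exact/neq/branch_refl.
- by rewrite edge_sym.
- exact/nonadj/branch_refl.
Qed.

(** Pigeonhole: a heavy bough is sent to the side of its chosen marked chord on which [v] lies, and
    this map into the booleans is injective. *)
Lemma realizable_heavy v : #|heavy_boughs v| <= 2.
Proof.
rewrite (card_heavy_boughs hT).
pose far y := [pred m | [&& m \in branch v y, m \in marked T & ~~ edge v m]].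
(* By [mkP] the default [v] never arises for a heavy neighbour. *)
pose mk y := odflt v [pick m | far y m].
have mkP y : y \in heavy_nbrs v -> far y (mk y).
  rewrite inE /mk => /andP[_ /exists_inP[m /setIP[my mM] vm]].
  by case: pickP => [//|/(_ m)]; rewrite /= my mM vm.
have -> : 2 = #|[set: bool]| by rewrite cardsT card_bool.
have inj : {in heavy_nbrs v &, injective (fun y => side (mk y) v == 0)}.
  move=> y1 y2 h1 h2 E; apply/eqP/negPn/negP => y12.
  have /and3P[m1 M1 n1] := mkP _ h1; have /and3P[m2 M2 n2] := mkP _ h2.
  move: h1 h2; rewrite !inE => /andP[vy1 _] /andP[vy2 _].
  have s2 := side_branch vy1 vy2 y12 m1 m2 M2 n2.
  have y21 : y2 != y1 by rewrite eq_sym.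
  have s1 := side_branch vy2 vy1 y21 m2 m1 M1 n1.
  have m12 : mk y1 != mk y2.
    apply: contraNneq y21 => mE; apply/eqP/(branch_inj hT vy1 vy2).
    move: m1 m2; rewrite mE !inE => m1 m2; apply: connect_trans m1 _.
    by rewrite connect_minusC.
  (* The two sides add up to 2, yet by [E] they would be both 0 or both 2. *)
  have := side_swap M1 m12; rewrite -s1 -s2.
  have [] := side02 M1 (branch_neq vy1 m1); first by rewrite edge_sym.
    by move: E => /[swap] ->; rewrite eqxx => /esym/eqP->.
  move=> e1; move: E; rewrite e1 => E.
  have [] := side02 M2 (branch_neq vy2 m2); first by rewrite edge_sym.
    by move=> e2; rewrite e2 in E.
  by move=> ->.
rewrite -(card_in_imset inj); exact: subset_leq_card (subsetT _).
Qed.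

End Necessity.

Theorem theorem1 (T : marked_graph) (hT : is_tree T) :
  (exists (n : nat) (D : chord_diagram 2 n),
      isomorphic T (marked_intersection_graph D)) <->
  (forall v : vertex T, #|heavy_boughs v| <= 2).
Proof.
split=> [/realizable_words[w1 [w2 R]] v|le2].
  exact: realizable_heavy R v.
exact/realizable_words/heavy_realizable.
Qed.
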